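(* Let $\Gamma$ be a divisible design graph with parameters $(v,k,\lambda_1,\lambda_2,m,n)$, where $\lambda_2=2k-v$. Then the following statements hold. (1) If $\lambda_1\neq k-1$, then the vertex connectivity of $\Gamma$ equals $k$. (2) If $\lambda_1=k-1$, then the vertex connectivity of $\Gamma$ equals $k-1$.
   Context: A $k$-regular graph on $v$ vertices is called a divisible design graph (DDG) with parameters $(v,k,\lambda_1,\lambda_2,m,n)$ if its vertex set can be partitioned into $m$ classes of size $n$ such that two distinct vertices from the same class have exactly $\lambda_1$ common neighbours, and two vertices from different classes have exactly $\lambda_2$ common neighbours. The vertex connectivity $\varkappa(G)$ of a graph $G$ is the minimum number of vertices whose deletion from $G$ disconnects it.
   Formalization: Part (2) additionally assumes that Γ is not a complete graph: complete graphs meet the definition with λ1 = k−1 and λ2 = 2k−v, but no vertex deletion disconnects them, and by the usual convention their connectivity is v−1 = k, not k−1. *)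

(* Defs.v *)
From mathcomp Require Import all_boot.

Set Implicit Arguments.
Unset Strict Implicit.
Unset Printing Implicit Defensive.

Definition simple_graph (V : finType) (e : rel V) : Prop :=
  symmetric e /\ irreflexive e.

Definition complete_graph (V : finType) (e : rel V) : Prop :=
  forall x y : V, x != y -> e x y.

Definition regular_graph (V : finType) (e : rel V) (k : nat) : Prop :=
  forall x : V, #|[set z | e x z]| = k.

Definition common_neighbours (V : finType) (e : rel V) (x y : V) : {set V} :=
  [set z | e x z && e y z].

(* [partition P setT] has disjoint nonempty blocks covering V.  The degenerate
   cases m = 1, n = 1 and l1 = l2 are allowed; the graph with no vertices is
   not. *)
Definition divisible_design_graph (V : finType) (e : rel V)
    (v k l1 l2 m n : nat) : Prop :=
  [/\ simple_graph e, #|V| = v, 0 < v, regular_graph e k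
    & exists P : {set {set V}},
      [/\ partition P [set: V],
          #|P| = m,
          forall B : {set V}, B \in P -> #|B| = n,
          forall (B : {set V}) (x y : V), B \in P -> x \in B -> y \in B ->
            x != y -> #|common_neighbours e x y| = l1
        & forall (B C : {set V}) (x y : V), B \in P -> C \in P -> B != C ->
            x \in B -> y \in C -> #|common_neighbours e x y| = l2]].

(* Two of the vertices left after deleting S lie in different components of
   the subgraph induced on the complement of S. *)
Definition disconnecting (V : finType) (e : rel V) (S : {set V}) : bool :=
  [exists x in ~: S, exists y in ~: S,
     ~~ connect [rel u w in ~: S | e u w] x y].

(* A disconnecting set leaves at least two vertices, so the default value
   #|V|.-1 never affects the minimum when such a set exists; it is attained
   exactly by complete graphs, which no deletion disconnects, and realizes the
   usual convention that K_v has connectivity v - 1. *)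
Definition vertex_connectivity (V : finType) (e : rel V) : nat :=
  \big[minn/#|V|.-1]_(S : {set V} | disconnecting e S) #|S|.

(* Main.v *)
(* Since l2 = 2k - v, the neighbourhoods of two vertices in different classes
   cover V, so vertices in different classes are adjacent and the graph is the
   join of its classes.  Inside a class C every vertex has r = k - (v - n)
   neighbours and any two have mu = l1 - (v - n) common ones, whence
   r^2 = r + mu (n - 1).  A disconnecting set contains all of V but one class
   C, so it remains to separate C into A and B with no edges in between, by a
   set of s vertices of C.  Cauchy-Schwarz applied to the numbers of
   neighbours in A, which vanish on B, gives mu a b <= (r - mu) s; if s < r,
   the union of the neighbourhoods of two adjacent vertices of A gives
   a > r - mu, so mu b < s.  Likewise mu a < s, and
   mu n = mu (a + b + s) is then too small unless mu = r - 1.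
   If mu = r - 1, then r = n - 1, and the graph is complete, or r = 1, and the
   classes are perfect matchings, separated by deleting the other classes. *)
Require Import Defs.
From mathcomp Require Import all_boot.
From mathcomp Require Import zify.

Set Implicit Arguments.
Unset Strict Implicit.
Unset Printing Implicit Defensive.

(** * Double counting and Cauchy-Schwarz inside one class *)

Lemma sqr_sum_le (T : finType) (D : {set T}) (f : T -> nat) :
  (\sum_(z in D) f z) ^ 2 <= #|D| * \sum_(z in D) f z ^ 2.
Proof.
have sum2 : \sum_(i in D) \sum_(j in D) (f i ^ 2 + f j ^ 2)
    = 2 * (#|D| * \sum_(z in D) f z ^ 2).
  rewrite (eq_bigr (fun i => #|D| * f i ^ 2 + \sum_(j in D) f j ^ 2)).
    by rewrite big_split /= -big_distrr /= sum_nat_const; lia.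
  by move=> i _; rewrite big_split /= sum_nat_const.
have : 2 * (\sum_(z in D) f z) ^ 2 <= 2 * (#|D| * \sum_(z in D) f z ^ 2).
  rewrite -sum2 -mulnn big_distrl big_distrr /=; apply: leq_sum => i _.
  rewrite !big_distrr /=; apply: leq_sum => j _.
  exact: nat_Cauchy.
by rewrite leq_pmul2l.
Qed.

(** For a simple graph [e], the subgraph induced on [C] is a (v,k,lambda)-graph: its neighbourhoods
    are the blocks of a symmetric design. *)
Definition design_on (V : finType) (e : rel V) (C : {set V}) (r mu : nat) :=
  (forall x, x \in C -> #|[set z in C | e x z]| = r) /\
  (forall x y, x \in C -> y \in C -> x != y ->
     #|C :&: common_neighbours e x y| = mu).

Definition no_edges (V : finType) (e : rel V) (A B : {set V}) :=
  forall x y, x \in A -> y \in B -> e x y = false.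

Lemma card_set_sum (T : finType) (C : {set T}) (p : pred T) :
  #|[set z in C | p z]| = \sum_(z in C) (p z : nat).
Proof. by rewrite -sum1dep_card big_mkcondr; apply: eq_bigr => z _; case: (p z). Qed.

Lemma design_sum (V : finType) (e : rel V) (C A : {set V}) (r mu : nat) :
  design_on e C r mu -> A \subset C ->
  \sum_(z in C) \sum_(x in A) (e x z : nat) = #|A| * r.
Proof.
move=> [hr _] /subsetP sAC; rewrite exchange_big /= -sum_nat_const.
by apply: eq_bigr => x xA; rewrite -card_set_sum hr ?sAC.
Qed.

(** Expanding the square counts ordered pairs from [A] with a common neighbour in [C]: a diagonal
    pair contributes [r], any other [mu]. *)
Lemma design_sum_sqr (V : finType) (e : rel V) (C A : {set V}) (r mu : nat) :
  design_on e C r mu -> A \subset C ->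
  \sum_(z in C) (\sum_(x in A) (e x z : nat)) ^ 2
    = #|A| * (r + #|A|.-1 * mu).
Proof.
move=> [hr hmu] /subsetP sAC.
rewrite (eq_bigr (fun z => \sum_(x in A) \sum_(y in A) (e x z && e y z : nat))).
  rewrite exchange_big /= -sum_nat_const; apply: eq_bigr => x xA.
  rewrite exchange_big /= (bigD1 x) //=; congr (_ + _).
    by rewrite -(hr x (sAC _ xA)) card_set_sum; apply: eq_bigr => z _; rewrite andbb.
  have -> : #|A|.-1 = #|A :\ x| by rewrite (cardsD1 x A) xA.
  rewrite -sum_nat_const (eq_bigl (fun y => y \in A :\ x)) => [|y]; last first.
    by rewrite !inE andbC.
  apply: eq_bigr => y; rewrite in_setD1 => /andP[yx yA].
  rewrite -card_set_sum -(hmu x y) ?sAC // 1?eq_sym //.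
  by apply: eq_card => z; rewrite !inE.
move=> z _; rewrite -mulnn big_distrl /=; apply: eq_bigr => x _.
by rewrite big_distrr /=; apply: eq_bigr => y _; rewrite mulnb.
Qed.

(** The case [A = C] of the second moment, where symmetry makes every inner sum equal to [r]. *)
Lemma design_param (V : finType) (e : rel V) (C : {set V}) (r mu : nat) :
  symmetric e -> design_on e C r mu -> 0 < #|C| -> r * r = r + #|C|.-1 * mu.
Proof.
move=> sym hD C_gt0; have := @design_sum_sqr V e C C r mu hD (subxx _).
rewrite (eq_bigr (fun=> r ^ 2)) => [|z zC].
  by rewrite sum_nat_const -mulnn => /eqP; rewrite eqn_pmul2l // => /eqP.
rewrite -(proj1 hD z zC) card_set_sum.
by congr (_ ^ 2); apply: eq_bigr => x _; rewrite sym.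
Qed.

Lemma design_separation (V : finType) (e : rel V) (C A B S : {set V})
    (r mu : nat) :
  symmetric e -> design_on e C r mu -> A \subset C ->
  no_edges e A B -> B \subset C -> 0 < #|A| ->
  #|C| = #|A| + #|B| + #|S| ->
  mu * (#|A| * #|B|) + mu * #|S| <= r * #|S|.
Proof.
move=> sym hD sAC nAB sBC A_gt0 cC.
have par := @design_param V e C r mu sym hD (leq_trans A_gt0 (subset_leq_card sAC)).
(* Both moments live on [C :\: B], so Cauchy-Schwarz applies with [#|A| + #|S|] terms only; [F] will
   be the square and the identity. *)
have outB (F : nat -> nat) : F 0 = 0 ->
    \sum_(z in C) F (\sum_(x in A) (e x z : nat))
    = \sum_(z in C :\: B) F (\sum_(x in A) (e x z : nat)).
  move=> F0; rewrite (big_setID B) /= big1 ?add0n // => z /setIP[_ zB].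
  by rewrite big1 // => x xA; rewrite (nAB x z).
have := sqr_sum_le (C :\: B) (fun z => \sum_(x in A) (e x z : nat)).
rewrite -(outB (fun n => n ^ 2)) // -(outB id) //=.
rewrite (@design_sum V e C A r mu) // (@design_sum_sqr V e C A r mu) //.
have -> : #|C :\: B| = #|A| + #|S|.
  by move: (cardsID B C); rewrite (setIidPr sBC); lia.
move: A_gt0 cC par; case: #|A| => // a _ -> /=.
rewrite -mulnn => par.
have -> : a.+1 * r * (a.+1 * r) = a.+1 * (a.+1 * (r * r)) by lia.
rewrite [leqRHS]mulnCA leq_pmul2l // par.
nia.
Qed.

Lemma design_component (V : finType) (e : rel V) (C A B S : {set V})
    (r mu : nat) :
  symmetric e -> irreflexive e -> design_on e C r mu -> A \subset C ->
  B \subset C -> no_edges e A B -> 0 < #|A| ->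
  A :|: B :|: S = C -> #|C| = #|A| + #|B| + #|S| ->
  0 < #|S| < r -> mu < r -> mu * #|B| < #|S|.
Proof.
move=> sym irr hD sAC sBC nAB A_gt0 eC cC /andP[S_gt0 Sr] mur.
have sep := @design_separation V e C A B S r mu sym hD sAC nAB sBC A_gt0 cC.
have [hr hmu] := hD.
have nbAS x : x \in A -> [set z in C | e x z] \subset A :|: S.
  move=> xA; apply/subsetP=> z; rewrite inE -eC !inE => /andP[/orP[/orP[zA|zB]|zS] exz].
  - by rewrite zA.
  - by rewrite nAB in exz.
  - by rewrite zS orbT.
have [x xA] := card_gt0P A_gt0.
(* [x] has [r > #|S|] neighbours in [A :|: S], so some neighbour lies in [A]. *)
have [w wA exw] : exists2 w, w \in A & e x w.
  have /subsetPn[w] : ~~ ([set z in C | e x z] \subset S).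
    by apply/negP=> /subset_leq_card; rewrite hr ?(subsetP sAC) //; lia.
  move=> wN wS; have := subsetP (nbAS x xA) w wN.
  by move: wN; rewrite !inE (negbTE wS) orbF => /andP[_ exw] wA; exists w.
have xw : x != w by apply: contraTneq exw => <-; rewrite irr.
have unionAS : r + r <= #|A| + #|S| + mu.
  have <- := hmu x w (subsetP sAC _ xA) (subsetP sAC _ wA) xw.
  have <- : [set z in C | e x z] :&: [set z in C | e w z]
            = C :&: common_neighbours e x w.
    by apply/setP=> z; rewrite !inE; case: (z \in C).
  rewrite -{1}(hr x) ?(subsetP sAC) // -(hr w) ?(subsetP sAC) //.
  rewrite -cardsUI leq_add2r (leq_trans _ (leq_card_setU A S)) //.
  by rewrite subset_leq_card // subUset !nbAS.
(* As [#|S| < r], [unionAS] gives [#|A| > r - mu], whereas [sep] and [SB] give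
   [#|A| * #|S| <= (r - mu) * #|S|]. *)
rewrite ltnNge; apply/negP=> SB; nia.
Qed.

Lemma design_separator_ge (V : finType) (e : rel V) (C A B S : {set V})
    (r mu : nat) :
  symmetric e -> irreflexive e -> design_on e C r mu ->
  no_edges e A B -> 0 < #|A| -> 0 < #|B| ->
  A :|: B :|: S = C -> #|C| = #|A| + #|B| + #|S| -> mu.+1 <> r -> r <= #|S|.
Proof.
move=> sym irr hD nAB A_gt0 B_gt0 eC cC mur1; rewrite leqNgt; apply/negP=> Sr.
have sAC : A \subset C by rewrite -eC -setUA subsetUl.
have sBC : B \subset C by rewrite -eC setUAC subsetUr.
have nBA : no_edges e B A by move=> x y xB yA; rewrite sym nAB.
have par := @design_param V e C r mu sym hD (leq_trans A_gt0 (subset_leq_card sAC)).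
have [x xA] := card_gt0P A_gt0; have [y yB] := card_gt0P B_gt0.
have [xC yC] := (subsetP sAC x xA, subsetP sBC y yB).
have muS : mu <= #|S|.
  have xy : x != y.
    (* The sizes of [A], [B], [S] add up to that of their union, so [A] and [B] cannot meet. *)
    apply/negP=> /eqP xy; have disj : #|A| + #|B| <= #|A :|: B|.
      by have [+ _] := leq_card_setU (A :|: B) S; rewrite eC cC; lia.
    have := cardsUI A B; have : 0 < #|A :&: B|.
      by apply/card_gt0P; exists x; rewrite inE xA xy.
    by lia.
  rewrite -(proj2 hD x y xC yC xy) subset_leq_card //; apply/subsetP=> z.
  rewrite !inE -eC !inE => /andP[/orP[/orP[zA|zB]|//]] /andP[exz eyz].
    by rewrite nBA in eyz.
  by rewrite nAB in exz.
(* If [r = 1], then [S] is empty and [mu = 0], the excluded case; next, [mu = 0] would force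
   [r * r = r]. *)
have r_gt1 : 1 < r by lia.
have mu_gt0 : 0 < mu by rewrite lt0n; apply/eqP => mu0; nia.
have S_gt0 : 0 < #|S| < r by lia.
have mur : mu < r by lia.
have bB : mu * #|B| < #|S|.
  exact: (@design_component V e C A B S r mu).
have bA : mu * #|A| < #|S|.
  apply: (@design_component V e C B A S r mu) => //; first by rewrite (setUC B).
  by rewrite (addnC #|B|).
rewrite cC in par.
have {}par : r * r + mu = r + mu * #|A| + mu * #|B| + mu * #|S| by nia.
(* Since [mu * #|A|] and [mu * #|B|] are at most r - 2, this yields r^2 + mu <= r + 2(r - 2) + mu(r
   - 1), impossible for mu <= r - 2. *)
have : mu * #|S| <= mu * r.-1 by rewrite leq_mul2l; lia.
nia.
Qed.

(** * Disconnecting sets and general bounds on the connectivity *)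

Lemma disconnectingP (V : finType) (e : rel V) (S : {set V}) :
  disconnecting e S -> exists A B : {set V},
    [/\ 0 < #|A|, 0 < #|B|, A :|: B = ~: S, [disjoint A & B] & no_edges e A B].
Proof.
case/exists_inP=> x xS /exists_inP[y yS nxy].
set f := [rel u w in ~: S | e u w] in nxy.
(* The component of [x] outside [S], and the rest. *)
exists [set u in ~: S | connect f x u], [set u in ~: S | ~~ connect f x u].
split.
- by apply/card_gt0P; exists x; rewrite inE xS connect0.
- by apply/card_gt0P; exists y; rewrite inE yS.
- by apply/setP=> u; rewrite !inE -andb_orr orbN andbT.
- rewrite -setI_eq0; apply/eqP/setP=> u; rewrite !inE.
  by case: (connect f x u); rewrite ?andbF.
move=> u w; rewrite !inE => /andP[uS cu] /andP[wS]; apply: contraNF => euw.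
by apply: connect_trans cu _; apply: connect1; rewrite /f /= !inE uS wS.
Qed.

Lemma disconnectingI (V : finType) (e : rel V) (S A : {set V}) (x y : V) :
  x \in A -> x \notin S -> y \notin A -> y \notin S ->
  no_edges e A (~: S :\: A) -> disconnecting e S.
Proof.
move=> xA xS yA yS nA; apply/exists_inP; exists x; rewrite ?inE //.
apply/exists_inP; exists y; rewrite ?inE //; apply/negP=> /connectP[p].
elim: p x xA {xS} => [|w p IHp] u uA /=; first by move=> _ yu; rewrite yu uA in yA.
case/andP=> /andP[/andP[_ wS] euw]; apply: IHp; apply: contraTT euw => wA.
by rewrite (nA u w) // inE wA wS.
Qed.

Lemma vertex_connectivity_le (V : finType) (e : rel V) (S : {set V}) :
  disconnecting e S -> vertex_connectivity e <= #|S|.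
Proof.
move=> dS; rewrite /vertex_connectivity.
elim: (index_enum _) (mem_index_enum S) => // T s IHs.
rewrite inE big_cons => /predU1P[<-|/IHs le_s]; first by rewrite dS geq_minl.
by case: ifP => // _; apply: leq_trans (geq_minr _ _) le_s.
Qed.

(** The bound by [#|V|.-1] takes care of the default value of the minimum. *)
Lemma vertex_connectivity_ge (V : finType) (e : rel V) (k : nat) :
  k <= #|V|.-1 -> (forall S, disconnecting e S -> k <= #|S|) ->
  k <= vertex_connectivity e.
Proof.
move=> kV kS; rewrite /vertex_connectivity.
by elim/big_ind: _ => // a b ka kb; rewrite leq_min ka.
Qed.

Lemma regular_degree_le (V : finType) (e : rel V) (k : nat) (x : V) :
  irreflexive e -> regular_graph e k -> k <= #|V|.-1.
Proof.
move=> irr reg; rewrite -(reg x) -(cardsC1 x) subset_leq_card //.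
by apply/subsetP=> z; rewrite !inE; apply: contraTneq => ->; rewrite irr.
Qed.

Lemma neighbourhood_disconnecting (V : finType) (e : rel V) (x y : V) :
  irreflexive e -> x != y -> ~~ e x y -> disconnecting e [set z | e x z].
Proof.
move=> irr xy exy; apply: (@disconnectingI V e _ [set x] x y).
- by rewrite inE.
- by rewrite inE irr.
- by rewrite inE eq_sym.
- by rewrite inE.
by move=> u z /set1P->; rewrite !inE => /andP[_ /negbTE].
Qed.

(** Deleting the neighbourhood of a vertex cuts it off from a non-neighbour; in a complete graph the
    default value is [k]. *)
Lemma regular_connectivity_le (V : finType) (e : rel V) (k : nat) (x0 : V) :
  irreflexive e -> regular_graph e k -> vertex_connectivity e <= k.
Proof.
move=> irr reg.
case: (boolP [exists x, exists y, (x != y) && ~~ e x y]).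
  case/existsP=> x /existsP[y /andP[xy exy]]; rewrite -(reg x).
  exact/vertex_connectivity_le/(neighbourhood_disconnecting irr xy).
move/existsPn=> cpl; have {}cpl x y : x != y -> e x y.
  by move=> xy; move/existsPn: (cpl x) => /(_ y); rewrite xy /= negbK.
have -> : k = #|V|.-1.
  rewrite -(reg x0) -(cardsC1 x0); apply: eq_card => z; rewrite !inE.
  by apply/idP/idP=> [|zx]; [apply: contraTneq => ->; rewrite irr | rewrite cpl // eq_sym].
rewrite /vertex_connectivity; elim/big_rec: _ => // S m _ mV.
exact: leq_trans (geq_minr _ _) mV.
Qed.

(** * The join of classes and its separators *)

Theorem proposition7 (V : finType) (e : rel V) (v k l1 l2 m n : nat)
    (ddg : divisible_design_graph e v k l1 l2 m n)
    (hl2 : l2 + v = 2 * k) :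
  (l1 <> k - 1 -> vertex_connectivity e = k) /\
  (l1 = k - 1 -> ~ complete_graph e -> vertex_connectivity e = k - 1).
Proof.
case: ddg => [[sym irr] cV v_gt0 reg [P [parP _ cB same diff]]].
have [x0 _] : exists x0, x0 \in V by apply/card_gt0P; rewrite cV.
have k_gt0 : 0 < k by lia.
have kV := @regular_degree_le V e k x0 irr reg.
have cover x : exists2 C, C \in P & x \in C.
  by apply/bigcupP; rewrite -/(cover P) (cover_partition parP) inE.
have cross C x z : C \in P -> x \in C -> z \notin C -> e x z.
  move=> CP xC zC; have [D DP zD] := cover z.
  have CD : C != D by apply: contraNneq zC => ->.
  (* The union has 2k - l2 = v vertices, so it contains [z], which is not its own neighbour and
     hence is adjacent to [x]. *)
  have UT : #|[set w | e x w] :|: [set w | e z w]| = #|V|.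
    have := cardsUI [set w | e x w] [set w | e z w]; rewrite !reg.
    have -> : [set w | e x w] :&: [set w | e z w] = common_neighbours e x z.
      by apply/setP=> w; rewrite !inE.
    by rewrite (diff C D) //; lia.
  have /setP/(_ z) : [set w | e x w] :|: [set w | e z w] = [set: V].
    by apply/eqP; rewrite eqEcard subsetT cardsT UT leqnn.
  by rewrite !inE irr orbF => ->.
have same_class C x y : C \in P -> x \in C -> ~~ e x y -> y \in C.
  by move=> CP xC; apply: contraNT; apply: cross CP xC.
have cC C : C \in P -> #|~: C| = v - n by move=> CP; rewrite cardsCs setCK cV cB.
(* [w] is now the number of vertices outside a class. *)
move: (v - n) cC => w cC.
have out_le C x : C \in P -> x \in C ->
    #|[set z in C | e x z]| + w = k.
  move=> CP xC; rewrite -(reg x) -(cC C CP) -(cardsID C [set z | e x z]).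
  congr (_ + _); apply: eq_card => z; rewrite !inE; first by rewrite andbC.
  by case zC: (z \in C) => //=; rewrite (cross C) ?zC.
have common C x y : C \in P -> x \in C -> y \in C -> x != y ->
    #|C :&: common_neighbours e x y| + w = l1.
  move=> CP xC yC xy; rewrite -(same C x y) // -(cC C CP).
  rewrite -(cardsID C (common_neighbours e x y)) setIC.
  congr (_ + _); apply: eq_card => z; rewrite !inE.
  by case zC: (z \in C) => //=; rewrite !(cross C) ?zC.
have design C : C \in P -> design_on e C (k - w) (l1 - w).
  move=> CP; split=> [x xC|x y xC yC xy].
    by have := out_le C x CP xC; lia.
  by have := common C x y CP xC yC xy; lia.
have sep S : disconnecting e S -> exists C A B : {set V},
    C \in P /\ A :|: B \subset C /\
    [/\ 0 < #|A|, 0 < #|B|, A :|: B = ~: S, [disjoint A & B] & no_edges e A B].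
  case/disconnectingP=> A [B [A_gt0 B_gt0 AB dAB nAB]].
  have [[x xA] [y yB]] := (card_gt0P A_gt0, card_gt0P B_gt0).
  have [C CP xC] := cover x; exists C, A, B; split=> //.
  split=> //.
  have BC z : z \in B -> z \in C.
    by move=> zB; apply: (same_class C x) => //; rewrite nAB.
  rewrite subUset; apply/andP; split; apply/subsetP=> z; last exact: BC.
  by move=> zA; apply: (same_class C y) => //; [exact: BC | rewrite sym nAB].
split=> [l1k|l1k ncpl].
  apply/eqP; rewrite eqn_leq regular_connectivity_le //=.
  apply: vertex_connectivity_ge => // S /sep[C [A [B]]].
  case=> CP [ABC [A_gt0 B_gt0 AB dAB nAB]].
  have sCS : ~: C \subset S by rewrite -setCS setCK -AB.
  have eC : A :|: B :|: (S :&: C) = C.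
    rewrite AB; apply/setP=> z; rewrite !inE; case zS: (z \in S) => //=.
    by rewrite (subsetP ABC) // AB inE zS.
  have c1 : #|S| = #|S :&: C| + w.
    by rewrite -(cardsID C S) setDE (setIidPr sCS) cC //.
  have c2 : #|C| = #|A| + #|B| + #|S :&: C|.
    have AB0 : A :&: B = set0 by apply/eqP; rewrite setI_eq0.
    have ABS0 : (A :|: B) :&: (S :&: C) = set0.
      by rewrite AB setIA (setIC (~: S)) setICr set0I.
    by rewrite -{1}eC cardsU ABS0 cardsU AB0 cards0 !subn0.
  have [[x xA] [y yB]] := (card_gt0P A_gt0, card_gt0P B_gt0).
  have xC : x \in C by rewrite (subsetP ABC) // inE xA.
  have yC : y \in C by rewrite (subsetP ABC) // inE yB orbT.
  have xy : x != y by apply: contraTneq yB => <-; rewrite (disjointFr dAB).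
  (* The distinct vertices [x], [y] of [C] witness [w <= l1] and [w <= k], so neither subtraction is
     truncated. *)
  have mur : (l1 - w).+1 <> k - w.
    by move: (common C x y CP xC yC xy) (out_le C x CP xC) l1k; clear; lia.
  rewrite c1 addnC -leq_subLR.
  exact: design_separator_ge sym irr (design C CP) nAB A_gt0 B_gt0 eC c2 mur.
apply/eqP; rewrite eqn_leq; apply/andP; split; last first.
  apply: vertex_connectivity_ge => [|S /sep[C [A [B]]]]; first by lia.
  case=> CP [ABC [A_gt0 B_gt0 AB dAB nAB]].
  have [[x xA] [y yB]] := (card_gt0P A_gt0, card_gt0P B_gt0).
  have xC : x \in C by rewrite (subsetP ABC) // inE xA.
  have yC : y \in C by rewrite (subsetP ABC) // inE yB orbT.
  have xy : x != y by apply: contraTneq yB => <-; rewrite (disjointFr dAB).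
  (* A common neighbour of [x] in [A] and [y] in [B] can only lie in [S]. *)
  rewrite -l1k -(same C x y CP xC yC xy) subset_leq_card //.
  apply/subsetP=> z; rewrite inE => /andP[exz eyz]; apply: contraTT exz.
  rewrite -in_setC -AB inE => /orP[zA|zB]; last by rewrite nAB.
  by rewrite sym nAB in eyz.
have /existsP[x /existsP[y /andP[xy exy]]] : [exists x, exists y, (x != y) && ~~ e x y].
  apply: contraT => /existsPn H; case: ncpl => x y xy.
  by move/existsPn: (H x) => /(_ y); rewrite xy /= negbK.
have [C CP xC] := cover x; have yC := same_class C x y CP xC exy.
have hC := design C CP; have n_gt0 : 0 < #|C| by apply/card_gt0P; exists x.
have par := @design_param V e C _ _ sym hC n_gt0.
have outx := out_le C x CP xC; have comx := common C x y CP xC yC xy.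
have r_lt : #|[set z in C | e x z]|.+2 <= #|C|.
  rewrite (cardsD1 x C) xC (cardsD1 y (C :\ x)) !inE eq_sym xy yC ltnS ltnS.
  apply: subset_leq_card; apply/subsetP=> z; rewrite !inE => /andP[-> exz].
  by rewrite andbT; apply/andP; split; apply: contraTneq exz => ->; rewrite ?irr.
(* With mu = r - 1, [par] reads r(r - 1) = (n - 1)(r - 1), and [r_lt] rules out r = n - 1. *)
have r1 : k - w = 1.
  have r_eq : k - w = (l1 - w).+1 by lia.
  rewrite r_eq in par *; nia.
have /eqP/cards1P[x' Nx] := etrans (proj1 hC x xC) r1.
have [x'C exx'] : x' \in C /\ e x x'.
  by have := set11 x'; rewrite -Nx inE => /andP[].
have /eqP/cards1P[u Nw] := etrans (proj1 hC x' x'C) r1.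
have ux : x = u by apply/set1P; rewrite -Nw inE xC sym.
rewrite (_ : k - 1 = #|~: C|); last by rewrite cC //; lia.
(* [x] and [x'] are each other's only neighbours in [C], so deleting the other classes leaves the
   edge [[set x; x']] as a component that misses [y]. *)
apply: vertex_connectivity_le; apply: (@disconnectingI V e _ [set x; x'] x y).
- by rewrite !inE eqxx.
- by rewrite inE xC.
- rewrite !inE eq_sym (negbTE xy) /=; by apply: contraNneq exy => ->.
- by rewrite inE yC.
move=> a z; rewrite !inE !negbK negb_or => /orP[]/eqP-> /andP[/andP[zx zx'] zC].
  by apply: contraNF zx' => exz; rewrite -in_set1 -Nx inE zC.
by apply: contraNF zx => exz; rewrite ux -in_set1 -Nw inE zC.
Qed.
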